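(* Let $k\ge 3$, $n_1,\dots,n_k\ge 2$, $r\in[k]$, let $j\in[k]$ be an index with $n_j=\min\{n_1,\dots,n_k\}$, and let $f(k,n_j)=(n_j-1)(k-1)+\tfrac{(n_j-2)(n_j-1)}{2}-\tfrac{(k-2)(k-1)}{2}$. Let $G\in\mathcal{O}(CS^r_{n_1,\dots,n_k})$ have the minimum number of edges among graphs in this orbit. Then: (1) If $k$ is even, then $G=\Gamma(\text{star toward }j;\ t_j=\mathrm{sc},\ t_i=\mathrm{ss}\ \forall i\ne j)$, and $|E(G)|=n_j(k-1)+\sum_{i\ne j}(n_i-1)$. (2) If $k$ is odd and $f(k,n_j)>0$, then $G=\Gamma(\text{complete};\ t_i=\mathrm{ss}\ \forall i)$ (a multi-leaf repeater graph), and $|E(G)|=\tfrac{k(k-1)}{2}+\sum_{i=1}^k(n_i-1)$. (3) If $k$ is odd and $f(k,n_j)<0$, then $G=\Gamma(\text{star toward }j;\ t_j=\mathrm{c},\ t_i=\mathrm{ss}\ \forall i\ne j)$, and $|E(G)|=n_j(k-1)+\tfrac{n_j(n_j-1)}{2}+\sum_{i\ne j}(n_i-1)$. If $f(k,n_j)=0$, the graphs of cases (2) and (3) have the same number of edges and both are minimal in the orbit.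
   Context: $V=U_1\sqcup\cdots\sqcup U_k$ with $|U_i|=n_i$. The clique-star $CS^r_{n_1,\dots,n_k}$: each $U_i$ is a clique, every vertex of $U_r$ is adjacent to every vertex of each $U_i$, $i\ne r$, no edges between $U_i,U_l$ for distinct $i,l\ne r$. The local complement $c_v(G)$ complements the edges among the neighbours of $v$; $\mathcal{O}(G)$ is the set of graphs on $V$ obtainable from $G$ by finite sequences of local complements. Graph family $\Gamma$: assign to each $i$ a type $t_i\in\{\mathrm{c},\mathrm{sc},\mathrm{ss}\}$: $\mathrm{c}$: $U_i$ a clique, $R_i=U_i$; $\mathrm{sc}$: $U_i$ independent, $R_i=U_i$; $\mathrm{ss}$: a center $c_i\in U_i$ adjacent to all other vertices of $U_i$, no other internal edges, $R_i=\{c_i\}$. Central type ''complete'': for all $i\ne l$, all edges between $R_i$ and $R_l$; ''star toward $j$'': for each $i\ne j$ all edges between $R_i$ and $R_j$, no other edges between different parts.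
   Formalization: When several indices attain the minimum, G need not be the star toward the given j (e.g. k=4, all n_i=2); the formal theorem says G is the star toward some j' with n_{j'}=n_j, for some choice of centers, and likewise in the f=0 clause, stated for odd k. *)

(* Defs.v *)
From mathcomp Require Import all_boot all_order all_algebra.
Set Implicit Arguments. Unset Strict Implicit. Unset Printing Implicit Defensive.
Import GRing.Theory Num.Theory.

Section Defs.
Variables (k : nat) (n : 'I_k -> nat).

Definition vert := {i : 'I_k & 'I_(n i)}.
Definition part (x : vert) : 'I_k := tag x.

(* A simple graph on vert: its symmetric, irreflexive set of ordered adjacent pairs. *)
Definition graph := {set vert * vert}.
Definition adj (G : graph) (x y : vert) : bool := (x, y) \in G.

Definition mk_graph (a : vert -> vert -> bool) : graph :=
  [set p : vert * vert | (p.1 != p.2) && a p.1 p.2].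

Definition nedges (G : graph) : nat :=
  #|[set e : {set vert} | (#|e| == 2) &&
       [forall x in e, forall y in e, (x != y) ==> adj G x y]]|.

Definition clique_star (r : 'I_k) : graph :=
  mk_graph (fun x y => [|| part x == part y, part x == r | part y == r]).

Definition local_compl (v : vert) (G : graph) : graph :=
  [set p : vert * vert |
     if [&& p.1 != p.2, adj G v p.1 & adj G v p.2] then p \notin G else p \in G].

Inductive in_LC_orbit (G0 : graph) : graph -> Prop :=
| orbit_refl : in_LC_orbit G0 G0
| orbit_step : forall G v, in_LC_orbit G0 G -> in_LC_orbit G0 (local_compl v G).

Inductive part_type := Tc | Tsc | Tss.
Inductive central_type := Complete | StarToward of 'I_k.

(* t : types of the parts, c : a choice of center in each part (only used for ss). *)
Definition inR (t : 'I_k -> part_type) (c : forall i : 'I_k, 'I_(n i)) (x : vert) : bool :=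
  match t (tag x) with
  | Tss => tagged x == c (tag x)
  | _ => true
  end.

Definition Gamma (ct : central_type) (t : 'I_k -> part_type)
    (c : forall i : 'I_k, 'I_(n i)) : graph :=
  mk_graph (fun x y =>
    if tag x == tag y then
      match t (tag x) with
      | Tc => true
      | Tsc => false
      | Tss => (tagged x == c (tag x)) || (tagged y == c (tag y))
      end
    else
      [&& inR t c x, inR t c y &
        match ct with
        | Complete => true
        | StarToward j => (tag x == j) || (tag y == j)
        end]).

End Defs.
Arguments Complete {k}.

Definition fkn (k nj : nat) : rat :=
  (nj%:R - 1) * (k%:R - 1) + (nj%:R - 2) * (nj%:R - 1) / 2%:R
  - (k%:R - 2) * (k%:R - 1) / 2%:R.

(* Main.v *)
Require Import Defs.
From mathcomp Require Import all_boot all_order all_algebra.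
From mathcomp Require Import zify ring lra.
Import GRing.Theory Num.Theory.
Set Implicit Arguments. Unset Strict Implicit. Unset Printing Implicit Defensive.

(* A local complement at a vertex of some [R_i] maps a graph [Gamma ct t c] to
   another one, the central graph undergoing the local complement at the marker
   [i]; at any other vertex it does nothing. Starting from the clique-star, each
   type takes one of two values determined by the central type, and one parity
   is invariant; the states of that parity are exactly the ones reached. The
   edges are then minimised over these states. For a star centre toward [j],
   every part of type [c] other than [U_j], and for a complete centre every part
   of type [sc], adds more edges than any saving available elsewhere, which
   leaves one candidate for [k] even and two for [k] odd. The difference between
   these two is [f(k, n_j)]. *)

(** * Local complements of the graphs [Gamma] *)

Section LocalComplement.
Variables (k : nat) (n : 'I_k -> nat).
Implicit Types (G H : graph n) (ct : central_type k) (t : 'I_k -> part_type).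
Implicit Types (c : forall i, 'I_(n i)) (b : 'I_k -> bool) (x y v : vert n).

(** The central graph of the split decomposition, whose vertices are the markers, one for each
    part. *)
Definition cadj ct (a d : 'I_k) : bool :=
  (a != d) && match ct with Complete => true | StarToward j => (a == j) || (d == j) end.

Definition central_lc (i : 'I_k) ct : central_type k :=
  match ct with
  | Complete => StarToward i
  | StarToward j => if i == j then Complete else StarToward j
  end.

(** A part and its marker form a component of the split decomposition: a clique for [Tc], a star
    centred at the marker for [Tsc], a star with the marker as a leaf for [Tss]. The component of
    [i] is complemented at a vertex of [R_i], and each component whose marker is adjacent to [i] at
    its own marker. *)
Definition type_lc (i : 'I_k) ct t (l : 'I_k) : part_type :=
  if l == i then match t l with Tc => Tss | Tsc => Tsc | Tss => Tc end
  else if cadj ct i l then match t l with Tc => Tsc | Tsc => Tc | Tss => Tss end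
  else t l.

Definition inner_adj t c x y : bool :=
  match t (tag x) with
  | Tc => true
  | Tsc => false
  | Tss => (tagged x == c (tag x)) || (tagged y == c (tag y))
  end.

Lemma adj_Gamma ct t c x y :
  adj (Gamma ct t c) x y = (x != y) &&
    if tag x == tag y then inner_adj t c x y
    else [&& inR t c x, inR t c y & cadj ct (tag x) (tag y)].
Proof.
rewrite /adj /Gamma /mk_graph inE /=; congr (_ && _); rewrite /inner_adj /cadj.
by case: (tag x =P tag y) => //= _; case: (t (tag x)).
Qed.

Lemma adj_ext G H : (forall x y, adj G x y = adj H x y) -> G = H.
Proof. by move=> E; apply/setP=> -[x y]; exact: E. Qed.

Lemma eq_Gamma ct t t' c : t =1 t' -> Gamma ct t c = Gamma ct t' c.
Proof.
by move=> E; apply: adj_ext => x y; rewrite !adj_Gamma /inner_adj /inR !E.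
Qed.

Lemma adj_local_compl v G x y :
  adj (local_compl v G) x y =
    if [&& x != y, adj G v x & adj G v y] then ~~ adj G x y else adj G x y.
Proof. by rewrite /adj inE. Qed.

Lemma cadj_lc i ct a d :
  cadj (central_lc i ct) a d =
    if [&& a != d, cadj ct i a & cadj ct i d] then ~~ cadj ct a d else cadj ct a d.
Proof.
rewrite /cadj /central_lc; case: ct => [|j] /=.
  rewrite !andbT (eq_sym i a) (eq_sym i d).
  by case: (a =P d); case: (a =P i); case: (d =P i).
case: (i =P j) => [->|ij] /=; rewrite ?(eq_sym i) ?(eq_sym j);
  do !case: eqP => //=; congruence.
Qed.

Lemma vert_eq x y : (x == y) = (tag x == tag y) && (tagged x == tagged_as x y).
Proof. by []. Qed.

(** A part of type [Tc] becomes a star centred at [v], hence the update of [c]. For [Tss] the centre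
    is [v] already, and for [Tsc] it does not matter. *)
Lemma inR_dfwith ct t c v x : inR t c v ->
  inR (type_lc (tag v) ct t) (dfwith c (tagged v)) x =
    if tag x == tag v then (if t (tag v) is Tc then x == v else true)
    else inR t c x.
Proof.
case: v => i v; case: x => l x; rewrite /inR /type_lc /=.
case: (l =P i) => [e|ne] /=.
  subst l; rewrite dfwith_in; case: (t i) => //= _.
  by rewrite vert_eq /= eqxx tagged_asE.
rewrite dfwith_out; last by apply/eqP=> e; apply: ne.
by case: cadj; case: (t l).
Qed.

Lemma cadj_sym ct a d : cadj ct a d = cadj ct d a.
Proof. by rewrite /cadj eq_sym; case: ct => // j; rewrite orbC. Qed.

Lemma cadjxx ct a : cadj ct a a = false.
Proof. by rewrite /cadj eqxx. Qed.

Lemma inner_adj_R t c v x y : inR t c v -> tag x = tag v -> tag y = tag v ->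
  inner_adj t c x y =
    match t (tag v) with Tc => true | Tsc => false | Tss => (x == v) || (y == v) end.
Proof.
case: v x y => i v [i' x] [i'' y] /= Rv e e'; subst i' i''.
move: Rv; rewrite /inR /inner_adj /=; case: (t i) => //= /eqP <-.
by rewrite !vert_eq /= eqxx !tagged_asE.
Qed.

Lemma inR_R t c v x : inR t c v -> tag x = tag v ->
  inR t c x = if t (tag v) is Tss then x == v else true.
Proof.
case: v x => i v [i' x] /= Rv e; subst i'.
move: Rv; rewrite /inR /=; case: (t i) => //= /eqP <-.
by rewrite vert_eq /= eqxx tagged_asE.
Qed.

Lemma adj_Gamma_R ct t c v x : inR t c v ->
  adj (Gamma ct t c) v x = (x != v) &&
    if tag x == tag v then (if t (tag v) is Tsc then false else true)
    else inR t c x && cadj ct (tag v) (tag x).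
Proof.
move=> Rv; rewrite adj_Gamma eq_sym (eq_sym (tag v)) Rv /inner_adj.
by move: Rv; rewrite /inR; case: (t (tag v)) => // ->.
Qed.

Lemma inner_adj_dfwith ct t c v x y : inR t c v -> tag x = tag y -> x != y ->
  inner_adj (type_lc (tag v) ct t) (dfwith c (tagged v)) x y =
    if tag x == tag v then
      match t (tag v) with Tc => (x == v) || (y == v) | Tsc => false | Tss => true end
    else if cadj ct (tag v) (tag x) && inR t c x && inR t c y then ~~ inner_adj t c x y
    else inner_adj t c x y.
Proof.
case: v => i v; case: x => l x; case: y => l' y Rv /= e; subst l' => xy.
have {}xy : x != y by move: xy; rewrite vert_eq /= eqxx tagged_asE.
rewrite /inner_adj /inR /type_lc /=.
case: (l =P i) => [e|ne] /=.
  subst l; rewrite dfwith_in; case: (t i) => //=.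
  by rewrite !vert_eq /= eqxx !tagged_asE.
rewrite dfwith_out; last by apply/eqP=> e; apply: ne.
(* For [Tss], [R_l] is a single vertex, so two distinct vertices of the part are never both
   neighbours of [v]. *)
case: cadj; case: (t l) => //=; case: eqP => //= ex; case: eqP => //= ey.
by case/eqP: xy; rewrite ex ey.
Qed.

(** The neighbours of [v] are the rest of its part, unless this is independent, and the sets [R_l]
    with [l] adjacent to the marker of [v]. Pairs are compared inside one part, between the part of
    [v] and another, and between two other parts. *)
Lemma local_compl_Gamma ct t c v : inR t c v ->
  local_compl v (Gamma ct t c) =
    Gamma (central_lc (tag v) ct) (type_lc (tag v) ct t) (dfwith c (tagged v)).
Proof.
move=> Rv; apply: adj_ext => x y; rewrite adj_local_compl.
rewrite !(adj_Gamma_R _ _ Rv) !adj_Gamma.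
have [->|xy] /= := eqVneq x y; first by [].
rewrite !inR_dfwith // cadj_lc.
have [txy|txy] /= := eqVneq (tag x) (tag y).
  rewrite inner_adj_dfwith // -txy.
  have [txv|txv] := eqVneq (tag x) (tag v); last first.
    have -> : x != v by apply: contraNneq txv => ->.
    have -> : y != v by apply: contraNneq txv => <-; rewrite txy.
    by rewrite /=; case: cadj; case: inR; case: inR.
  have tyv : tag y = tag v by rewrite -txy.
  rewrite (inner_adj_R Rv) //; case: (t (tag v)) => //=;
    by case: (x == v); case: (y == v).
have nxv : tag x != tag v -> x != v by apply: contraNneq => ->.
have nyv : tag y != tag v -> y != v by apply: contraNneq => ->.
have [txv|txv] /= := eqVneq (tag x) (tag v).
  have tyv : tag y != tag v by rewrite -txv eq_sym.
  rewrite (negPf tyv) (nyv tyv) txv cadjxx /=.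
  rewrite (inR_R Rv txv).
  by case: (t (tag v)); case: (x == v); case: inR; case: cadj.
have [tyv|tyv] /= := eqVneq (tag y) (tag v).
  rewrite (nxv txv) tyv cadjxx /=.
  rewrite (inR_R Rv tyv).
  rewrite (cadj_sym _ (tag x)).
  by case: (t (tag v)); case: (y == v); case: inR; case: cadj.
rewrite (nxv txv) (nyv tyv) /=.
by case: inR; case: inR; case: cadj; case: cadj.
Qed.

(** Outside [R] a vertex is a leaf whose only neighbour is the centre of its part, so there is no
    pair to complement. *)
Lemma local_compl_leaf ct t c v : ~~ inR t c v ->
  local_compl v (Gamma ct t c) = Gamma ct t c.
Proof.
move=> Rv; apply: adj_ext => x y; rewrite adj_local_compl.
suff nbr z : adj (Gamma ct t c) v z -> z = Tagged (fun i => 'I_(n i)) (c (tag v)).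
  by case: ifP => // /and3P [/eqP + /nbr ex /nbr ey]; rewrite ex ey.
rewrite adj_Gamma (negPf Rv) /inner_adj; case: v z Rv => i v [l z].
rewrite /inR /=; case: (t i) => //= /negPf ->; rewrite andbC.
by case: (i =P l) => //= e; subst l => /andP [/eqP ->].
Qed.

(* Reading the marker of each part in the split decomposition, only two of the
   three types are possible for a given central type; [b l] records which one,
   encoded so that every local complement preserves the parity of [\sum_l b l]. *)
Definition bit_type ct b (l : 'I_k) : part_type :=
  match ct with
  | Complete => if b l then Tss else Tsc
  | StarToward j =>
      if l == j then (if b l then Tc else Tsc) else (if b l then Tss else Tc)
  end.

(** Passing between the complete graph and a star changes types but no bit. Only at a leaf [i] of
    the star toward [j] do bits change, and then those of [i] and [j] flip together. *)
Definition bit_lc (i : 'I_k) ct b (l : 'I_k) : bool :=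
  match ct with
  | Complete => b l
  | StarToward j => b l (+) [&& i != j & (l == i) || (l == j)]
  end.

Lemma type_lc_bit i ct b :
  type_lc i ct (bit_type ct b) =1 bit_type (central_lc i ct) (bit_lc i ct b).
Proof.
move=> l; rewrite /type_lc /bit_type /bit_lc /central_lc /cadj.
case: ct => [|j].
  by rewrite andbT (eq_sym i l); case: (l == i); case: (b l).
rewrite (eq_sym i l); case: (l =P i) => [->|li] /=.
  by case: (i =P j) => [_|/eqP/negPf ij] /=; rewrite ?ij; case: (b i).
case: (i =P j) => [ij|ij] /=; case: (l =P j) => [lj|lj] /=; rewrite ?addbF; try (by case: (b l)); by case: li; rewrite ij lj.
Qed.

Definition odd_bits b := odd (\sum_(l < k) b l).

Lemma eq_odd_bits b b' : b =1 b' -> odd_bits b = odd_bits b'.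
Proof. by move=> E; congr odd; apply: eq_bigr => l _; rewrite E. Qed.

Lemma odd_bits_flip2 b (i j : 'I_k) : i != j ->
  odd_bits (fun l => b l (+) ((l == i) || (l == j))) = odd_bits b.
Proof.
move=> ij; have split2 (f : 'I_k -> nat) :
    \sum_l f l = f i + (f j + \sum_(l | (l != i) && (l != j)) f l).
  by rewrite (bigD1 i) //= (bigD1 j) // eq_sym.
rewrite /odd_bits !split2 !eqxx orbT /=.
under eq_bigr => l /andP [/negPf li /negPf lj] do rewrite li lj addbF.
by rewrite !oddD; case: (b i); case: (b j) => /=; case: (odd _).
Qed.

Lemma odd_bits_lc i ct b : odd_bits (bit_lc i ct b) = odd_bits b.
Proof.
case: ct => //= j; have [->|ij] := eqVneq i j.
  by apply: eq_odd_bits => l; rewrite /= eqxx addbF.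
by rewrite -(odd_bits_flip2 b ij); apply: eq_odd_bits => l; rewrite /= ij.
Qed.

Lemma local_compl_bits ct b c v : inR (bit_type ct b) c v ->
  local_compl v (Gamma ct (bit_type ct b) c) =
    Gamma (central_lc (tag v) ct)
      (bit_type (central_lc (tag v) ct) (bit_lc (tag v) ct b)) (dfwith c (tagged v)).
Proof.
by move=> Rv; rewrite local_compl_Gamma //; apply: eq_Gamma => l; exact: type_lc_bit.
Qed.

(** All parts have type [Tc], which is bit 1 at the centre [r] and bit 0 elsewhere; no part uses
    [c]. *)
Lemma clique_star_bits r c :
  clique_star n r =
    Gamma (StarToward r) (bit_type (StarToward r) (fun l => l == r)) c.
Proof.
apply/setP=> -[x y]; rewrite -!/(adj _ x y) adj_Gamma /adj inE /=; congr (_ && _).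
rewrite /inner_adj /inR /bit_type /cadj /part.
have E l : (if l == r then (if l == r then Tc else Tsc)
            else if l == r then Tss else Tc) = Tc by case: eqP.
by rewrite !E; case: eqP.
Qed.

Lemma odd_bits_pred1 r : odd_bits (fun l => l == r).
Proof.
by rewrite /odd_bits (bigD1 r) //= eqxx big1 // => l /negPf ->.
Qed.

(** * The orbit of the clique-star as the states of odd parity *)

Section Orbit.
Variable r : 'I_k.
Hypothesis n_gt0 : forall i, 0 < n i.

Lemma orbit_bits G : in_LC_orbit (clique_star n r) G ->
  exists ct b c, odd_bits b /\ G = Gamma ct (bit_type ct b) c.
Proof.
elim=> {G} [|G v _ [ct [b [c [ob ->]]]]].
  exists (StarToward r), (fun l => l == r), (fun i => Ordinal (n_gt0 i)).
  by rewrite odd_bits_pred1 -clique_star_bits.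
have [Rv|Rv] := boolP (inR (bit_type ct b) c v); last first.
  by exists ct, b, c; rewrite local_compl_leaf.
do 3!eexists; split; last exact: local_compl_bits.
by rewrite odd_bits_lc.
Qed.

(** The centres stay existential, as edge counts do not depend on them. *)
Let reach ct b := exists c, in_LC_orbit (clique_star n r) (Gamma ct (bit_type ct b) c).

Let reach_ext ct b b' : b =1 b' -> reach ct b -> reach ct b'.
Proof.
move=> E [c Hc]; exists c; rewrite (eq_Gamma _ (t' := bit_type ct b)) // => l.
by rewrite /bit_type E.
Qed.

Let reach_lc i ct b : reach ct b -> reach (central_lc i ct) (bit_lc i ct b).
Proof.
move=> [c Hc]; pose v : vert n := Tagged (fun i => 'I_(n i)) (c i).
exists (dfwith c (tagged v)); rewrite -(@local_compl_bits _ _ _ v).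
  exact: orbit_step.
by rewrite /inR /=; case: bit_type.
Qed.

Let reach_StarToward_r b : odd_bits b -> reach (StarToward r) b.
Proof.
have [m] := ubnP #|[pred i | (i != r) && b i]|; elim: m b => // m IH b le_m ob.
case: (pickP [pred i | (i != r) && b i]) => [i /= /andP [ir bi]|b0].
  (* Flipping the bits of [i] and [r] clears bit [i], which lowers the induction measure; a local
     complement at [i] flips them back. *)
  pose b' l := b l (+) ((l == i) || (l == r)).
  have /(reach_lc i) : reach (StarToward r) b'.
    apply: IH; last by rewrite odd_bits_flip2.
    move: le_m; rewrite (cardD1 i) inE ir bi ltnS; apply: leq_trans.
    rewrite add1n ltnS; apply: subset_leq_card; apply/subsetP => l; rewrite !inE /b'.
    by case: (l =P i) => [->|] /=; [rewrite bi andbF | case: (l =P r) => //; rewrite addbF].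
  rewrite /= (negPf ir); apply: reach_ext => l; rewrite /b' /bit_lc ir /=.
  by rewrite -addbA addbb addbF.
exists (fun i => Ordinal (n_gt0 i)); rewrite (eq_Gamma _ (t' := bit_type (StarToward r) (pred1 r))).
  rewrite -clique_star_bits; exact: orbit_refl.
(* With no bit left outside [r], odd parity sets bit [r]: this is the clique-star itself. *)
have E l : b l = (l == r).
  have [->|lr] := eqVneq l r; last by have /= := b0 l; rewrite lr.
  move: ob; rewrite /odd_bits (bigD1 r) //= big1 ?addn0; first by case: (b r).
  by move=> l' l'r; have /= := b0 l'; rewrite l'r /= => ->.
by move=> l; rewrite /bit_type E.
Qed.

(** A complement at [r] turns the star toward [r] into the complete graph, and one at [j] turns that
    into the star toward [j], both with the same bits. *)
Lemma orbit_odd_bits ct b : odd_bits b ->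
  exists c, in_LC_orbit (clique_star n r) (Gamma ct (bit_type ct b) c).
Proof.
move=> ob; have cpl : reach Complete b.
  have := reach_lc r (reach_StarToward_r ob); rewrite /= eqxx.
  by apply: reach_ext => l; rewrite /= eqxx addbF.
by case: ct => // j; exact: (reach_lc j cpl).
Qed.
End Orbit.
End LocalComplement.

(** * Edge counts, doubled to avoid division *)

Section EdgeCount.
Variables (k : nat) (n : 'I_k -> nat).
Implicit Types (G : graph n) (ct : central_type k) (t : 'I_k -> part_type).
Implicit Types (c : forall i, 'I_(n i)) (b : 'I_k -> bool) (x y : vert n).

(** Sending an ordered pair to its underlying set has fibres of size two over the edges. *)
Lemma nedges_double G : (forall x, ~~ adj G x x) -> (forall x y, adj G x y = adj G y x) ->
  (nedges G).*2 = #|G|.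
Proof.
move=> Girr Gsym.
set E := [set e : {set vert n} | (#|e| == 2) &&
            [forall x in e, forall y in e, (x != y) ==> adj G x y]].
have pairP x y : [set x; y] \in E -> x != y /\ adj G x y.
  rewrite inE cards2; case: (eqVneq x y) => //= xy /forall_inP /(_ x).
  rewrite set21 => /(_ isT) /forall_inP /(_ y); rewrite set22 xy => /(_ isT) /=.
  by [].
have toE p : p \in G -> [set p.1; p.2] \in E.
  case: p => x y pG; have xy : x != y.
    by apply: contraTneq pG => ->; exact: Girr.
  rewrite inE cards2 xy /=; apply/forall_inP => u /set2P [] ->;
    apply/forall_inP => w /set2P [] -> /=; rewrite ?eqxx ?xy //=.
  by rewrite Gsym; apply/implyP.
rewrite -sum1_card (partition_big (fun p => [set p.1; p.2]) (mem E)) //=.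
rewrite /nedges -/E -mul2n mulnC -sum_nat_const; apply: eq_bigr => e eE.
have /cards2P [x [y [xy def_e]]] : #|e| == 2 by move: eE; rewrite inE => /andP [].
subst e; have [_ xyG] := pairP _ _ eE.
transitivity #|[set (x, y); (y, x)]|; first by rewrite cards2 xpair_eqE (negPf xy).
rewrite sum1dep_card; apply: esym; apply: eq_card => -[u w]; rewrite !inE /= !xpair_eqE; apply/idP/idP.
  case/andP => uwG /eqP e.
  have uw : u != w by apply: contraTneq uwG => ->; exact: Girr.
  have : u \in [set x; y] by rewrite -e set21.
  have : w \in [set x; y] by rewrite -e set22.
  by rewrite !inE => /orP [] /eqP ew /orP [] /eqP eu; subst u w; rewrite ?eqxx ?orbT //;
     move: uw; rewrite eqxx.
case/orP => /andP [/eqP -> /eqP ->]; first by rewrite [_ \in _]xyG eqxx.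
by rewrite setUC eqxx andbT; move: xyG; rewrite Gsym.
Qed.

(** The size of [R_a], which is the degree of the marker inside its component. *)
Definition marker_deg t (a : 'I_k) : nat := if t a is Tss then 1 else n a.

Definition inner_deg t (a : 'I_k) : nat :=
  match t a with Tc => n a * (n a).-1 | Tsc => 0 | Tss => 2 * (n a).-1 end.

Lemma sum_eq_ord m (u : 'I_m) : \sum_(w < m) (w == u) = 1.
Proof. by rewrite (bigD1 u) //= eqxx big1 // => w /negPf ->. Qed.

Lemma sum_neq_ord m (u : 'I_m) : \sum_(w < m) (w != u) = m.-1.
Proof.
have : \sum_(w < m) ((w == u) + (w != u)) = m.
  by under eq_bigr => w _ do rewrite addnC addn_negb; rewrite sum1_card card_ord.
by rewrite big_split /= sum_eq_ord => /(congr1 predn).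
Qed.

Lemma sum_inR t c a : \sum_(u < n a) inR t c (Tagged (fun i => 'I_(n i)) u) = marker_deg t a.
Proof.
rewrite /inR /marker_deg /=; case: (t a); rewrite ?sum_eq_ord //;
by rewrite sum1_card card_ord.
Qed.

Lemma card_Gamma ct t c :
  #|Gamma ct t c| = \sum_a inner_deg t a +
                    \sum_a \sum_(d | cadj ct a d) marker_deg t a * marker_deg t d.
Proof.
pose T := (fun i : 'I_k => 'I_(n i)).
have -> : #|Gamma ct t c| = \sum_x \sum_y adj (Gamma ct t c) x y.
  rewrite -sum1_card big_mkcond pair_big /=; apply: eq_bigr => -[x y] _ /=.
  by rewrite /adj; case: ifP.
have sum_vert (F : vert n -> nat) : \sum_x F x = \sum_a \sum_(u < n a) F (Tagged T u).
  rewrite sig_big_dep /=; apply: eq_bigr => -[a u] _ //.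
rewrite sum_vert -big_split /=; apply: eq_bigr => a _.
under eq_bigr => u _ do rewrite sum_vert.
rewrite exchange_big (bigD1 a) //=; congr (_ + _).
  transitivity (\sum_(u < n a) \sum_(w < n a)
     ((w != u) && match t a with Tc => true | Tsc => false
                           | Tss => (u == c a) || (w == c a) end)).
    apply: eq_bigr => u _; apply: eq_bigr => w _.
    by rewrite adj_Gamma /inner_adj /= eqxx vert_eq /= eqxx tagged_asE eq_sym.
  rewrite /inner_deg; case: (t a).
  - under eq_bigr => u _ do under eq_bigr => w _ do rewrite andbT.
    under eq_bigr => u _ do rewrite sum_neq_ord.
    by rewrite sum_nat_const card_ord.
  - by rewrite big1 // => u _; rewrite big1 // => w _; rewrite andbF.
  (* The centre of the star contributes [n a - 1], and each leaf contributes 1. *)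
  - rewrite (bigD1 (c a)) //= mul2n -addnn; congr (_ + _).
      by under eq_bigr => w _ do rewrite eqxx /= andbT; exact: sum_neq_ord.
    rewrite -[RHS](sum_neq_ord (c a)) [RHS]big_mkcond /= big_mkcond /=.
    apply: eq_bigr => u _; case: (eqVneq u (c a)) => //= uc.
    rewrite -[RHS](sum_eq_ord (c a)); apply: eq_bigr => w _; congr nat_of_bool.
    by case: (eqVneq w (c a)) => [->|]; rewrite ?andbF // eq_sym uc.
rewrite [RHS]big_mkcond [LHS]big_mkcond; apply: eq_bigr => d _.
have [->|da] := eqVneq d a; first by rewrite cadjxx.
have ad : a != d by rewrite eq_sym.
rewrite /=.
transitivity (\sum_(u < n a) \sum_(w < n d) inR t c (Tagged T u) *
     (inR t c (Tagged T w) * cadj ct a d)).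
  apply: eq_bigr => u _. apply: eq_bigr => w _.
  rewrite adj_Gamma /= (negPf ad) vert_eq /= (negPf ad) /=.
  by rewrite /cadj ad; case: inR; case: inR; case: ct => // j; case: (_ || _).
under eq_bigr => u _ do rewrite -big_distrr -big_distrl /=.
rewrite -big_distrl /= !sum_inR /cadj ad /=; case: ct => [|j]; rewrite ?muln1 //.
by case: (_ || _); rewrite ?muln0 ?muln1.
Qed.

Lemma nedges_Gamma ct t c :
  (nedges (Gamma ct t c)).*2 =
    \sum_a inner_deg t a + \sum_a \sum_(d | cadj ct a d) marker_deg t a * marker_deg t d.
Proof.
rewrite nedges_double ?card_Gamma //.
  by move=> x; rewrite adj_Gamma eqxx.
move=> x y; rewrite !adj_Gamma (eq_sym y) (eq_sym (tag y)).
case: (eqVneq x y) => //= xy; case: eqP => [e|ne]; last first.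
  by rewrite cadj_sym; case: inR; case: inR.
case: x y {xy} e => i x [i' y] /= e; subst i'.
by rewrite /inner_adj /=; case: (t i) => //; rewrite orbC.
Qed.

Lemma sum_cadj_star (j : 'I_k) (f : 'I_k -> nat) :
  \sum_a \sum_(d | cadj (StarToward j) a d) f a * f d = 2 * (f j * \sum_(a | a != j) f a).
Proof.
rewrite (bigD1 j) //= mul2n -addnn; congr (_ + _).
  rewrite big_distrr; apply: eq_bigl => d /=.
  by rewrite /cadj eqxx andbT eq_sym.
rewrite big_distrr; apply: eq_bigr => a aj /=.
rewrite (big_pred1 j) 1?mulnC // => d /=; rewrite /cadj (negPf aj) /=.
by case: (eqVneq d j) => [->|_]; rewrite ?andbF // aj.
Qed.

(** The set [R_j] has [n j] elements whatever bit [j] is. The term with [~~ b a] is the extra cost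
    of [Tc] over [Tss]; where [n a - 2] truncates, its factor [(n a).-1] vanishes. *)
Lemma nedges_star (j : 'I_k) b c : (forall i, 0 < n i) ->
  (nedges (Gamma (StarToward j) (bit_type (StarToward j) b) c)).*2 =
    b j * (n j * (n j).-1) +
    \sum_(a | a != j) (2 * n j + 2 * (n a).-1 + ~~ b a * ((n a).-1 * (2 * n j + (n a - 2)))).
Proof.
move=> n_gt0; rewrite nedges_Gamma sum_cadj_star (bigD1 j) //= -addnA; congr (_ + _).
  by rewrite /inner_deg /bit_type eqxx; case: (b j); rewrite ?mul1n.
rewrite mulnA big_distrr -big_split; apply: eq_bigr => a aj /=.
rewrite /inner_deg /marker_deg /bit_type eqxx (negPf aj) /=.
have := n_gt0 a; case: (n a) => // m _.
by case: (b a); case: (b j) => /=; case: m => [|m]; lia.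
Qed.

Lemma sum_ord_neq (j : 'I_k) m : \sum_(a | a != j) m = k.-1 * m.
Proof. by rewrite sum_nat_const cardC1 card_ord. Qed.

Lemma cadj_Complete a d : cadj (@Complete k) a d = (d != a).
Proof. by rewrite /cadj andbT eq_sym. Qed.

Lemma nedges_complete b c : (forall a, b a) ->
  (nedges (Gamma Complete (bit_type Complete b) c)).*2 = k * k.-1 + 2 * \sum_a (n a).-1.
Proof.
move=> b1; rewrite nedges_Gamma addnC /inner_deg /marker_deg /bit_type; congr (_ + _).
  under eq_bigr => a _.
    under eq_bigl => d do rewrite cadj_Complete.
    under eq_bigr => d _ do rewrite !b1 muln1.
    rewrite sum_ord_neq muln1; over.
  by rewrite sum_nat_const card_ord.
by rewrite big_distrr; apply: eq_bigr => a _; rewrite b1.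
Qed.

(* From [(1 + x) * (1 + y) >= 1 + x + y] for the excess marker degrees [x], [y]. *)
Lemma nedges_complete_ge b c : (forall i, 0 < n i) -> 2 <= k ->
  k * k.-1 + 2 * \sum_a (n a).-1 + 2 * (k - 2) * \sum_a ~~ b a * (n a).-1
    <= (nedges (Gamma Complete (bit_type Complete b) c)).*2.
Proof.
move=> n_gt0 k2; rewrite nedges_Gamma.
pose x a := ~~ b a * (n a).-1.
set X := \sum_a x a; set N := \sum_a (n a).-1.
(* Type [Tsc] saves [2 * X] inside the parts, while the edges between parts grow by at least
   [2 * k.-1 * X]; the balance is [2 * (k - 2) * X]. *)
have inner : \sum_a inner_deg (bit_type Complete b) a + 2 * X = 2 * N.
  rewrite !big_distrr -big_split; apply: eq_bigr => a _ /=.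
  by rewrite /inner_deg /bit_type /x; case: (b a) => /=; lia.
have cross : k * k.-1 + 2 * k.-1 * X <=
    \sum_a \sum_(d | cadj Complete a d)
      marker_deg (bit_type Complete b) a * marker_deg (bit_type Complete b) d.
  have mdE a : marker_deg (bit_type Complete b) a = (x a).+1.
    rewrite /marker_deg /bit_type /x; case: (b a) => //=.
    by rewrite mul1n prednK.
  apply: (@leq_trans (\sum_a \sum_(d | d != a) (1 + x a + x d))); last first.
    apply: leq_sum => a _; rewrite (eq_bigl _ _ (cadj_Complete a)).
    by apply: leq_sum => d _; rewrite !mdE; lia.
  have splitX a : \sum_(d | d != a) x d + x a = X by rewrite /X [RHS](bigD1 a) //= addnC.
  set S := \sum_a \sum_(d | _) _.
  have : S + X = \sum_a (k.-1 * (1 + x a) + X).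
    rewrite -big_split; apply: eq_bigr => a _ /=.
    by rewrite big_split /= sum_ord_neq -addnA splitX.
  rewrite big_split -big_distrr big_split /= !sum_nat_const card_ord muln1 -/X.
  by nia.
by nia.
Qed.
End EdgeCount.

(** * Comparison of the states *)

Lemma divn2_mul_pred m : 2 * (m * (m - 1) %/ 2) = m * (m - 1).
Proof.
case: m => // m; rewrite subn1 mulnC /= divnK // dvdn2 oddM /=.
by case: (odd m).
Qed.

(** This shows [fkn] as the edge count of case (3) minus that of case (2), once the leaves of the
    parts other than [j] have cancelled. *)
Lemma fknE (k m : nat) : 0 < k -> 0 < m ->
  (fkn k m = ((2 * m * k.-1 + m * m.-1)%:R - (k * k.-1 + 2 * m.-1)%:R) / 2)%R.
Proof.
by case: k m => // k [//|m] _ _; rewrite /fkn /= !(natrD, natrM, mulrS); field.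
Qed.

Section Minimum.
Variables (k : nat) (n : 'I_k -> nat) (j : 'I_k).
Implicit Types (b : 'I_k -> bool) (c : forall i, 'I_(n i)).
Hypotheses (k_ge3 : 3 <= k) (n_ge2 : forall i, 2 <= n i) (n_min : forall i, n j <= n i).

Local Notation N := (\sum_(i < k) (n i).-1).

(* Twice the number of edges of [Gamma] in case (1), for the star toward [i]. *)
Definition star_edges2 i := 2 * (n i * k.-1) + 2 * \sum_(a | a != i) (n a).-1.

Let n_gt0 i : 0 < n i. Proof. exact: ltnW. Qed.

Lemma sum_leaves i : \sum_(a | a != i) (n a).-1 + (n i).-1 = N.
Proof. by rewrite addnC [RHS](bigD1 i). Qed.

(** In this form [i] enters only through [(n i).-1 * (k - 2)], so the best centre is a smallest
    part. *)
Lemma star_edges2_eq i : star_edges2 i = 2 * k.-1 + 2 * N + 2 * ((n i).-1 * (k - 2)).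
Proof.
rewrite /star_edges2 -(sum_leaves i).
have [q [-> ->]] : exists q, k.-1 = q.+2 /\ k - 2 = q.+1 by exists (k - 3); lia.
have := n_gt0 i.
by case: (n i) => // m _ /=; lia.
Qed.

Lemma nedges_star_all i b c : (forall a, a != i -> b a) ->
  (nedges (Gamma (StarToward i) (bit_type (StarToward i) b) c)).*2 =
    star_edges2 i + b i * (n i * (n i).-1).
Proof.
move=> bT; rewrite nedges_star // addnC; congr (_ + _).
under eq_bigr => a ai do rewrite bT //= mul0n addn0.
by rewrite big_split /= sum_ord_neq -big_distrr /star_edges2 /=; lia.
Qed.

(** The part [i'] has type [Tc] and pays at least the last summand over [Tss]; the extra cost of the
    remaining parts is bounded below by 0. *)
Lemma nedges_star_ge i i' b c : i' != i -> ~~ b i' ->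
  star_edges2 i + b i * (n i * (n i).-1) + 2 * (n i * (n i').-1) <=
  (nedges (Gamma (StarToward i) (bit_type (StarToward i) b) c)).*2.
Proof.
move=> i'i bi'; rewrite nedges_star // (addnC (star_edges2 i)) -addnA leq_add2l.
rewrite (bigD1 i') //= bi' /star_edges2.
have -> : 2 * (n i * k.-1) + 2 * \sum_(a | a != i) (n a).-1 =
          \sum_(a | a != i) (2 * n i + 2 * (n a).-1).
  by rewrite big_split /= sum_ord_neq -big_distrr /= mulnA (mulnC (2 * n i)).
rewrite (bigD1 i') //= mul1n.
have : \sum_(a | (a != i) && (a != i')) (2 * n i + 2 * (n a).-1) <=
       \sum_(a < k | (a != i) && (a != i'))
          (2 * n i + 2 * (n a).-1 + ~~ b a * ((n a).-1 * (2 * n i + (n a - 2)))).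
  by apply: leq_sum => a _; apply: leq_addr.
by move=> le; rewrite addnAC; apply: leq_add le; rewrite leq_add2l; set p := (n i').-1; nia.
Qed.

(** One part of type [Tsc] contributes at least [(n j).-1] to the excess. The bound is
    [star_edges2 j] with [k * k.-1] in place of [2 * k.-1], and it also exceeds the count of case
    (2), whence the strictness. *)
Lemma nedges_complete_gt i' b c : ~~ b i' ->
  k * k.-1 + 2 * N + 2 * ((n j).-1 * (k - 2)) <=
  (nedges (Gamma Complete (bit_type Complete b) c)).*2.
Proof.
move=> bi'; apply: leq_trans (nedges_complete_ge _ _ n_gt0 _); last exact: ltnW.
rewrite leq_add2l -mulnA leq_mul2l /= mulnC leq_mul2l; apply/orP; right.
by rewrite (bigD1 i') //= bi' mul1n; have := n_min i'; lia.
Qed.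

Lemma star_edges2_le i : star_edges2 j <= star_edges2 i.
Proof. by rewrite !star_edges2_eq leq_add2l leq_mul2l /= leq_mul2r; have := n_min i; lia. Qed.

Lemma star_edges2_lt i : n i != n j -> star_edges2 j < star_edges2 i.
Proof.
move=> nij; rewrite !star_edges2_eq ltn_add2l ltn_mul2l /= ltn_mul2r subn_gt0 k_ge3 /=.
by have := n_min i; have := n_gt0 j; lia.
Qed.

(** Here the parity of [k] enters: if all bits but that of [i] are set, odd parity leaves bit [i]
    unset for [k] even and sets it for [k] odd. *)
Lemma odd_bits_but i b : (forall a, a != i -> b a) -> odd_bits b = odd k (+) ~~ b i.
Proof.
move=> bT; have -> : odd k = ~~ odd k.-1 by rewrite -oddS prednK // ltnW // ltnW.
rewrite /odd_bits (bigD1 i) //= (eq_bigr (fun=> 1)).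
  by rewrite sum_ord_neq muln1 oddD; case: (b i) => /=; case: odd.
by move=> a /bT ->.
Qed.
End Minimum.

Theorem theorem12 (k : nat) (n : 'I_k -> nat) (r j : 'I_k) (G : graph n) :
  3 <= k ->
  (forall i, 2 <= n i) ->
  (forall i, n j <= n i) ->
  in_LC_orbit (clique_star n r) G ->
  (forall H, in_LC_orbit (clique_star n r) H -> nedges G <= nedges H) ->
  [/\
   (* (1) k even *)
   ~~ odd k ->
     (exists2 j' : 'I_k, n j' = n j &
        exists c, G = Gamma (StarToward j') (fun i => if i == j' then Tsc else Tss) c)
     /\ nedges G = n j * (k - 1) + \sum_(i < k | i != j) (n i - 1),
   (* (2) k odd, f > 0 *)
   odd k -> (0 < fkn k (n j))%R ->
     (exists c, G = Gamma Complete (fun _ => Tss) c)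
     /\ nedges G = k * (k - 1) %/ 2 + \sum_(i < k) (n i - 1),
   (* (3) k odd, f < 0 *)
   odd k -> (fkn k (n j) < 0)%R ->
     (exists2 j' : 'I_k, n j' = n j &
        exists c, G = Gamma (StarToward j') (fun i => if i == j' then Tc else Tss) c)
     /\ nedges G = n j * (k - 1) + n j * (n j - 1) %/ 2 + \sum_(i < k | i != j) (n i - 1)
   &
   (* f = 0: both graphs have the same number of edges and both are minimal in the orbit *)
   odd k -> fkn k (n j) = 0%R ->
     k * (k - 1) %/ 2 + \sum_(i < k) (n i - 1)
       = n j * (k - 1) + n j * (n j - 1) %/ 2 + \sum_(i < k | i != j) (n i - 1)
     /\ (exists c, in_LC_orbit (clique_star n r) (Gamma Complete (fun _ => Tss) c)
                   /\ nedges (Gamma Complete (fun _ => Tss) c) = nedges G)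
     /\ (exists2 j' : 'I_k, n j' = n j &
          exists c, in_LC_orbit (clique_star n r)
                      (Gamma (StarToward j') (fun i => if i == j' then Tc else Tss) c)
                    /\ nedges (Gamma (StarToward j') (fun i => if i == j' then Tc else Tss) c)
                       = nedges G)].
Proof.
move=> k_ge3 n_ge2 n_min orbG minG.
have n_gt0 i : 0 < n i by apply: ltnW.
have k_gt0 : 0 < k by apply: leq_trans k_ge3.
have pred_sum (P : pred 'I_k) : \sum_(i < k | P i) (n i - 1) = \sum_(i | P i) (n i).-1.
  by apply: eq_bigr => i _; rewrite subn1.
rewrite !pred_sum !(subn1 k) !(subn1 (n j)).
set N := \sum_(i < k) (n i).-1; set S := \sum_(i < k | i != j) (n i).-1.
(* [A], [B] and [C] are the doubled edge counts of cases (1), (3) and (2). *)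
set C := k * k.-1 + 2 * N; set A := star_edges2 n j; set B := A + n j * (n j).-1.
have C2 : C = (k * k.-1 %/ 2 + N).*2.
  by rewrite /C -!(subn1 k) -mul2n mulnDr divn2_mul_pred.
have A2 : A = (n j * k.-1 + S).*2 by rewrite /A /star_edges2 -mul2n mulnDr.
have B2 : B = (n j * k.-1 + n j * (n j).-1 %/ 2 + S).*2.
  by rewrite addnAC doubleD -A2 -mul2n -(subn1 (n j)) divn2_mul_pred subn1.
have AE : A = 2 * k.-1 + 2 * N + 2 * ((n j).-1 * (k - 2)) by apply: star_edges2_eq.
(* [P] and [Q] are what remains of [C] and [B] without their common leaf terms, so
   [B + P = Q + C]. *)
pose P := k * k.-1 + 2 * (n j).-1; pose Q := 2 * n j * k.-1 + n j * (n j).-1.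
have fE : fkn k (n j) = ((B%:R - C%:R) / 2)%R.
  rewrite fknE // -/P -/Q; congr (_ / 2)%R; apply/eqP.
  rewrite subr_eq addrAC eq_sym subr_eq -!natrD eqr_nat addnC [Q + C]addnC eq_sym.
  by apply/eqP; rewrite /B /C /A /P /Q /star_edges2 -/S -(sum_leaves n j : S + _ = N); lia.
have minG2 H : in_LC_orbit (clique_star n r) H -> (nedges G).*2 <= (nedges H).*2.
  by rewrite leq_double; exact: minG.
have bitsT ct : odd k -> exists2 c,
    in_LC_orbit (clique_star n r) (Gamma ct (bit_type ct (fun=> true)) c) &
    (nedges (Gamma ct (bit_type ct (fun=> true)) c)).*2 =
      if ct is StarToward i then star_edges2 n i + n i * (n i).-1 else C.
  move=> ok; have [|c Hc] := orbit_odd_bits r n_gt0 ct (b := fun=> true).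
    by rewrite (odd_bits_but k_ge3 (i := j)) // ok.
  exists c => //; case: ct Hc => [|i] _; first exact: nedges_complete.
  by rewrite nedges_star_all // mul1n.
have [ct [b [c [ob defG]]]] := orbit_bits n_gt0 orbG.
have all_but i : (exists2 i', i' != i & ~~ b i') \/ (forall a, a != i -> b a).
  case: (pickP [pred i' | (i' != i) && ~~ b i']) => [i' /= /andP [? ?]|nob].
    by left; exists i'.
  by right=> a ai; have /= := nob a; rewrite ai /= => /negbFE.
have all_bits : (exists i', ~~ b i') \/ (forall a, b a).
  have [[i' _ nbi']|bT] := all_but j; first by left; exists i'.
  by case: (boolP (b j)) => bj; [right=> a; have [->|/bT] := eqVneq a j | left; exists j].
have evenG : ~~ odd k -> (exists2 j' : 'I_k, n j' = n j &
    exists c, G = Gamma (StarToward j') (fun i => if i == j' then Tsc else Tss) c)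
    /\ (nedges G).*2 = A.
  move=> /negPf ek; have le_A : (nedges G).*2 <= A.
    (* All bits but that of [j] are set: odd parity since [k] is even, and the candidate of case
       (1). *)
    pose b' (l : 'I_k) := l != j; have b'T a : a != j -> b' a by [].
    have [|c' /minG2] := orbit_odd_bits r n_gt0 (StarToward j) (b := b').
      by rewrite (odd_bits_but k_ge3 (i := j)) // ek /b' eqxx.
    by rewrite nedges_star_all // /b' eqxx mul0n addn0.
  case: ct defG => [|i] defG.
    have [[i' nbi']|bT] := all_bits; last first.
      by move: ob; rewrite (odd_bits_but k_ge3 (i := j)) // ek bT.
    have := nedges_complete_gt k_ge3 n_ge2 n_min c nbi'; rewrite -defG => /leq_trans /(_ le_A).
    rewrite AE leq_add2r leq_add2r leq_mul2r; move: k_ge3; lia.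
  have [[i' i'i nbi']|bT] := all_but i.
    have := nedges_star_ge k_ge3 n_ge2 c i'i nbi'; rewrite -defG => /leq_trans /(_ le_A).
    have := star_edges2_le k_ge3 n_ge2 n_min i; rewrite -/A => le1 le2.
    have : 0 < n i * (n i').-1 by rewrite muln_gt0 n_gt0 -subn1 subn_gt0 n_ge2.
    by lia.
  have bi : b i = false by move: ob; rewrite (odd_bits_but k_ge3 (i := i)) // ek; case: (b i).
  have neG : (nedges G).*2 = star_edges2 n i.
    by rewrite defG nedges_star_all // bi mul0n addn0.
  split; last first.
    by apply/eqP; rewrite eqn_leq le_A neG; exact: star_edges2_le.
  exists i.
    (* A centre in a larger part would give strictly more than [A] edges. *)
    apply/eqP; apply: contraLR le_A; rewrite neG -ltnNge => nij; exact: star_edges2_lt.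
  exists c; rewrite defG; apply: eq_Gamma => l; rewrite /bit_type.
  by have [->|/bT ->] := eqVneq l i; rewrite ?bi.
have oddG : odd k ->
    ((exists c, G = Gamma Complete (fun _ => Tss) c) /\ (nedges G).*2 = C) \/
    ((exists2 j' : 'I_k, n j' = n j &
     exists c, G = Gamma (StarToward j') (fun i => if i == j' then Tc else Tss) c)
    /\ (nedges G).*2 = B).
  move=> ok.
  have le_C : (nedges G).*2 <= C by have [c' /minG2 le ne] := bitsT Complete ok; rewrite -ne.
  have le_B : (nedges G).*2 <= B by have [c' /minG2 le ne] := bitsT (StarToward j) ok; rewrite /B /A -ne.
  case: ct defG => [|i] defG.
    left; have [[i' nbi']|bT] := all_bits.
      have := nedges_complete_gt k_ge3 n_ge2 n_min c nbi'; rewrite -defG => /leq_trans /(_ le_C).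
      have : 0 < (n j).-1 * (k - 2) by rewrite muln_gt0 -subn1 !subn_gt0 n_ge2.
      by rewrite -/N -/C; lia.
    split; last by rewrite defG nedges_complete.
    by exists c; rewrite defG; apply: eq_Gamma => l; rewrite /bit_type bT.
  right; have [[i' i'i nbi']|bT] := all_but i.
    have := nedges_star_ge k_ge3 n_ge2 c i'i nbi'; rewrite -defG => /leq_trans /(_ le_B).
    have := star_edges2_le k_ge3 n_ge2 n_min i; rewrite -/A => le1 le2.
    have : 0 < n i * (n i').-1 by rewrite muln_gt0 n_gt0 -subn1 subn_gt0 n_ge2.
    (* Hence the surplus [2 * (n i * (n i').-1)] outweighs the term [n j * (n j).-1] by which [B]
       exceeds [A]. *)
    have : n j * (n j).-1 <= n i * (n i').-1.
      by apply: leq_mul => //; rewrite -!subn1 leq_sub2r.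
    by move: le2; rewrite /B; lia.
  have bi : b i by move: ob; rewrite (odd_bits_but k_ge3 (i := i)) // ok; case: (b i).
  have neG : (nedges G).*2 = star_edges2 n i + n i * (n i).-1.
    by rewrite defG nedges_star_all // bi mul1n.
  have nij : n i = n j.
    apply/eqP; apply: contraLR le_B; rewrite neG -ltnNge => nij.
    apply: leq_trans (_ : star_edges2 n i + n j * (n j).-1 <= _).
      by rewrite ltn_add2r; exact: star_edges2_lt.
    by rewrite leq_add2l; apply: leq_mul => //; rewrite -!subn1 leq_sub2r.
  split; last by rewrite neG /B /A !(star_edges2_eq k_ge3) // nij.
  exists i => //; exists c; rewrite defG; apply: eq_Gamma => l; rewrite /bit_type.
  by have [->|/bT ->] := eqVneq l i; rewrite ?bi.
have eqE e e' : e.*2 = e'.*2 -> e = e' by move/double_inj.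
split.
- by move=> /evenG [? neG]; split=> //; apply: eqE; rewrite neG A2.
- move=> ok; rewrite fE => f_gt0; have ltCB : C < B.
    by rewrite -(ltr_nat rat); lra.
  case: (oddG ok) => [[? neG]|[_ neG]]; first by split=> //; apply: eqE; rewrite neG C2.
  (* If [G] were the star, the complete candidate, also in the orbit, would have fewer edges. *)
  by have [c' /minG2] := bitsT Complete ok; rewrite neG => + e; rewrite e leqNgt ltCB.
- move=> ok; rewrite fE => f_lt0; have ltBC : B < C.
    by rewrite -(ltr_nat rat); lra.
  case: (oddG ok) => [[_ neG]|[? neG]]; last by split=> //; apply: eqE; rewrite neG B2.
  by have [c' /minG2] := bitsT (StarToward j) ok; rewrite neG => + e; rewrite e leqNgt ltBC.
move=> ok; rewrite fE => f0; have eqBC : C = B.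
  by apply/eqP; rewrite -(eqr_nat rat); apply/eqP; lra.
have neG : (nedges G).*2 = C by case: (oddG ok) => -[_ ->].
have [c1 orb1 ne1] := bitsT Complete ok.
have [c2 orb2 ne2] := bitsT (StarToward j) ok.
split; first by apply: eqE; rewrite -C2 -B2.
split; first by exists c1; split=> //; apply: eqE; rewrite neG.
by exists j => //; exists c2; split=> //; apply: eqE; rewrite neG eqBC.
Qed.
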